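(* Let $c\in\mathbb{Q}^*$ and let $C_1\colon y^2=x^8+c$ over $\mathbb{Q}$. Let $p>3$ be a prime with $v_p(c)=0$, let $n=(p-1)/2$, and let $\overline{c}$ denote the image of $c$ in $\mathbb{F}_p$. Then the trace of Frobenius satisfies $$t_p(C_1)\equiv\begin{cases}\binom{n}{n/2}\overline{c}^{\,n/2}+\binom{n}{n/4}\overline{c}^{\,n/4}+\binom{n}{n/4}\overline{c}^{\,3n/4}&\text{if }p\equiv 1\bmod 8,\\[2pt] \binom{n}{n/2}\overline{c}^{\,n/2}&\text{if }p\equiv 5\bmod 8,\\[2pt] 0&\text{otherwise,}\end{cases}\pmod p.$$
   Context: $C_1$ is a genus 3 hyperelliptic curve, and $t_p(C_1):=p+1-\#\overline{C}_1(\mathbb{F}_p)$, where $\overline{C}_1$ is the smooth projective curve over $\mathbb{F}_p$ that is the reduction of $C_1$ modulo the prime $p$ of good reduction. The congruence modulo $p$ means that the image of the integer $t_p(C_1)$ in $\mathbb{F}_p$ equals the indicated element of $\mathbb{F}_p$. *)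

(* Defs.v *)
From HB Require Import structures.
From mathcomp Require Import all_boot all_order all_algebra all_field.

Set Implicit Arguments.
Unset Strict Implicit.
Unset Printing Implicit Defensive.

Import Order.TTheory GRing.Theory Num.Theory.
Local Open Scope ring_scope.

(* y^2 = f(x) defines a hyperelliptic curve of genus g; "size f" is
   deg f + 1, so deg f is 2g+1 or 2g+2. *)
Definition hyperelliptic_equation (F : fieldType) (g : nat) (f : {poly F}) :=
  [&& 2%:R != 0 :> F, separable_poly f &
      (size f == (2 * g + 2)%N) || (size f == (2 * g + 3)%N)].

Record hyperelliptic_curve (F : fieldType) (g : nat) := HyperellipticCurve {
  hyperelliptic_poly : {poly F};
  hyperelliptic_polyP : hyperelliptic_equation g hyperelliptic_poly
}.

(* The form of degree 2g+2 in (X, Z) that dehomogenizes to f at Z = 1. *)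
Definition homogenize (F : fieldType) (g : nat) (f : {poly F}) (X Z : F) : F :=
  \sum_(i < (2 * g + 3)%N) f`_i * X ^+ i * Z ^+ (2 * g + 2 - i).

(* The smooth projective curve with affine equation y^2 = f(x) is
     Y^2 = homogenize g f X Z
   in the weighted projective plane P(1, g+1, 1), where (X, Y, Z) is
   identified with (l X, l^(g+1) Y, l Z).  It lies in the locus where X and Z
   are not both 0; the chart Z = 1 is the affine curve y^2 = f(x), and the
   chart X = 1 covers the points at infinity.  Since X and Z have weight 1,
   its F-rational points are exactly the F^*-orbits of solutions in F^3. *)
Section RationalPoints.
Variables (F : finFieldType) (g : nat) (C : hyperelliptic_curve F g).

Definition weighted_orbit (P : F * F * F) : {set F * F * F} :=
  let: (X, Y, Z) := P in
  [set (l * X, l ^+ g.+1 * Y, l * Z) | l in [set l : F | l != 0]].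

Definition weighted_solutions : {set F * F * F} :=
  [set P : F * F * F | let: (X, Y, Z) := P in
     ((X, Z) != (0, 0)) &&
     (Y ^+ 2 == homogenize g (hyperelliptic_poly C) X Z)].

Definition rational_points : {set {set F * F * F}} :=
  [set weighted_orbit P | P in weighted_solutions].

End RationalPoints.

(* Only meaningful for x != 0. *)
Definition padic_valuation (p : nat) (x : rat) : int :=
  (logn p `|numq x|%N)%:Z - (logn p `|denq x|%N)%:Z.

(* The image of a p-integral rational in F_p is given by ratr. *)
Definition reduce_poly (p : nat) (f : {poly rat}) : {poly 'F_p} :=
  map_poly (fun x : rat => ratr x : 'F_p) f.

(* The given equation is p-integral and still defines a curve of genus g
   modulo p, so that reducing it gives a smooth proper model at p. *)
Definition good_reduction (p : nat) (g : nat) (C : hyperelliptic_curve rat g) :=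
  [&& prime p,
      all (fun x : rat => ~~ (p %| `|denq x|)%N) (hyperelliptic_poly C) &
      hyperelliptic_equation g (reduce_poly p (hyperelliptic_poly C))].

Lemma reduce_polyP (p g : nat) (C : hyperelliptic_curve rat g) :
  good_reduction p C ->
  hyperelliptic_equation g (reduce_poly p (hyperelliptic_poly C)).
Proof. by case/and3P. Qed.

Definition reduction (p g : nat) (C : hyperelliptic_curve rat g)
    (goodC : good_reduction p C) : hyperelliptic_curve 'F_p g :=
  HyperellipticCurve (reduce_polyP goodC).

Definition frobenius_trace (p g : nat) (C : hyperelliptic_curve rat g)
    (goodC : good_reduction p C) : int :=
  p%:Z + 1 - #|rational_points (reduction goodC)|%:Z.

Lemma X8_addC_hyperelliptic (F : fieldType) (c : F) :
  2%:R != 0 :> F -> c != 0 -> hyperelliptic_equation 3 ('X^8 + c%:P).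
Proof.
move=> two_neq0 c_neq0; rewrite /hyperelliptic_equation two_neq0.
rewrite size_XnaddC // orbT andbT /=.
have eight_neq0 : 8%:R != 0 :> F.
  by rewrite -[8%N]/(2 ^ 3)%N natrX expf_neq0.
rewrite separable_poly.unlock; apply/Bezout_coprimepP; exists (8%:R%:P, - 'X) => /=.
have -> : 8%:R%:P * ('X^8 + c%:P) + - 'X * ('X^8 + c%:P)^`()
          = (8%:R * c)%:P :> {poly F}.
  rewrite derivD derivXn derivC addr0 /= mulrDr -polyCM mulNr.
  rewrite mulrnAr -exprS polyC_natr mulr_natl addrAC subrr add0r.
  by [].
by rewrite polyC_eqp1 mulf_neq0.
Qed.

Lemma C1_equation (c : rat) :
  c != 0 -> hyperelliptic_equation 3 ('X^8 + c%:P).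
Proof. exact: X8_addC_hyperelliptic. Qed.

Definition C1 (c : rat) (c_neq0 : c != 0) : hyperelliptic_curve rat 3 :=
  HyperellipticCurve (C1_equation c_neq0).

Lemma padic_unit (p : nat) (c : rat) :
  c != 0 -> prime p -> padic_valuation p c = 0 ->
  ~~ (p %| `|numq c|)%N && ~~ (p %| `|denq c|)%N.
Proof.
move=> c_neq0 p_pr /eqP; rewrite subr_eq0 => /eqP[] eq_log.
have num_gt0 : (0 < `|numq c|)%N by rewrite absz_gt0 numq_eq0.
have den_gt0 : (0 < `|denq c|)%N by rewrite absz_gt0 denq_neq0.
have dvdE m : (0 < m)%N -> (p %| m)%N = (0 < logn p m)%N.
  by move=> m_gt0; rewrite logn_gt0 mem_primes p_pr m_gt0.
have eq_dvd : (p %| `|numq c|)%N = (p %| `|denq c|)%N.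
  by rewrite !dvdE // eq_log.
rewrite eq_dvd andbb; apply/negP => p_den.
have := coprime_num_den c; rewrite /coprime => /eqP co.
have : (p %| gcdn `|numq c| `|denq c|)%N by rewrite dvdn_gcd eq_dvd p_den.
by rewrite co dvdn1 => /eqP p1; rewrite p1 in p_pr.
Qed.

Lemma reduce_X8_addC (p : nat) (c : rat) :
  reduce_poly p ('X^8 + c%:P) = 'X^8 + (ratr c)%:P.
Proof.
have ratr0p : ratr 0 = 0 :> 'F_p by exact: (ratr_int _ 0).
have ratr1p : ratr 1 = 1 :> 'F_p by exact: (ratr_int _ 1).
apply/polyP => i; rewrite coef_map_id0 // !coefD !coefXn !coefC.
by case: i => [|i] /=; rewrite ?add0r ?addr0 //; case: eqP.
Qed.

Lemma C1_good_reduction (c : rat) (c_neq0 : c != 0) (p : nat) :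
  prime p -> (3 < p)%N -> padic_valuation p c = 0 ->
  good_reduction p (C1 c_neq0).
Proof.
move=> p_pr p_gt3 vc; have /andP[p_num p_den] := padic_unit c_neq0 p_pr vc.
have natF m : (m%:R == 0 :> 'F_p) = (p %| m)%N.
  by rewrite (dvdn_pcharf (pchar_Fp p_pr)).
have intF (z : int) : (z%:~R == 0 :> 'F_p) = (p %| `|z|)%N.
  by case: z => m; rewrite ?NegzE ?mulrNz ?oppr_eq0 -pmulrn natF ?abszN.
rewrite /good_reduction p_pr /=; apply/andP; split.
  apply/allP => x /(nthP 0) [i _ <-]; rewrite coefD coefXn coefC.
  have p1 : ~~ (p %| 1)%N by rewrite dvdn1; case: eqP p_pr => // ->.
  by case: i => [|i] /=; rewrite ?add0r ?addr0 //; case: eqP.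
rewrite reduce_X8_addC; apply: X8_addC_hyperelliptic.
  by rewrite natF; apply/negP => /(@dvdn_leq p 2 isT); rewrite leqNgt (ltnW p_gt3).
by rewrite mulf_neq0 ?invr_eq0 ?intF.
Qed.

(* Main.v *)
Require Import Defs.
From mathcomp Require Import all_boot all_order all_algebra all_field.
From mathcomp Require Import cyclic zify.

Set Implicit Arguments.
Unset Strict Implicit.
Unset Printing Implicit Defensive.

Import Order.TTheory GRing.Theory Num.Theory.
Local Open Scope ring_scope.

(** Write q for the number of elements of a finite field F of odd
    characteristic and n = (q - 1) / 2.  For a curve Y^2 = H(X, Z) in the
    weighted plane, F^* acts freely on the solutions with (X, Z) <> (0, 0), so
    their number is (q - 1) times the number of rational points, that is, minus
    that number in F.  By Euler's criterion a given (X, Z) carries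
    1 + H(X, Z)^n values of Y in F; summing over all (X, Z) the terms 1 vanish,
    and removing (0, 0) costs 1.  Hence, in F,

      1 - #points = sum over X and Z of H(X, Z)^n   ([hyperelliptic_trace]).

    Working with solutions in F^3 treats the points at infinity on the same
    footing as the others.

    For H = X^8 + c Z^8, the binomial expansion turns the double sum into
    products of power sums over F.  The sum of the x^m is -1 if m is a positive
    multiple of q - 1 and 0 otherwise ([power_sum]), so exactly the
    C(n, i) c^i with 0 < i < n and n | 4 i survive ([sum_X8_addC_exp]).  Such
    an i is n/4, n/2 or 3n/4, and the class of p modulo 8 tells which of these
    are integers. *)

(** * Finite fields: power sums and square roots *)

Section FiniteField.
Variable F : finFieldType.

Lemma expf_card_pred (x : F) : x != 0 -> x ^+ #|F|.-1 = 1.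
Proof.
move=> x_neq0; apply: (mulfI x_neq0); rewrite -exprS mulr1.
by rewrite prednK ?expf_card // ltnW ?finNzRing_gt1.
Qed.

Lemma card_pred_gt0 : (0 < #|F|.-1)%N.
Proof. by rewrite -ltnS prednK ?finNzRing_gt1 // ltnW ?finNzRing_gt1. Qed.

Lemma card_nonzero : #|[set l : F | l != 0]| = #|F|.-1.
Proof. by rewrite cardsE -(cardC1 (0 : F)); apply: eq_card. Qed.

(** Translating the variable by 1 in the sum of all elements of F changes it by
    the cardinal of F. *)
Lemma natr_card : #|F|%:R = 0 :> F.
Proof.
have /eqP : \sum_(x : F) x = \sum_(x : F) (x + 1).
  exact: (reindex_inj (addIr 1)).
by rewrite big_split /= addrC -subr_eq subrr sumr_const eq_sym => /eqP.
Qed.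

Lemma natr_card_pred : #|F|.-1%:R = -1 :> F.
Proof.
by apply/eqP; rewrite -addr_eq0 natr1 prednK ?natr_card // ltnW ?finNzRing_gt1.
Qed.

(** If q were even, the identity x^q = x at x = -1 would read 1 = -1. *)
Lemma odd_card : 2%:R != 0 :> F -> odd #|F|.
Proof.
apply: contraR => q_even; have := expf_card (-1 : F).
by rewrite -signr_odd (negbTE q_even) expr0 => /eqP; rewrite -addr_eq0.
Qed.

Lemma has_prim_root_card_pred : exists z : F, #|F|.-1.-primitive_root z.
Proof.
pose rs := enum [set l : F | l != 0].
have /(has_prim_root card_pred_gt0) H : all (#|F|.-1).-unity_root rs.
  apply/allP=> x; rewrite mem_enum inE unity_rootE => x_neq0.
  by rewrite expf_card_pred.
have /hasP[z _ z_prim] : has (#|F|.-1).-primitive_root rs.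
  by apply: H; rewrite ?enum_uniq // -cardE card_nonzero.
by exists z.
Qed.

(** Multiplication by a generator z of F^* permutes F, so the sum S satisfies
    S = z^m S, which forces S = 0 unless q - 1 divides m; when it does, every
    nonzero x contributes 1.  For m = 0 the convention 0^0 = 1 makes the sum
    equal to q = 0. *)
Lemma power_sum m :
  \sum_(x : F) x ^+ m = if (0 < m)%N && (#|F|.-1 %| m)%N then -1 else 0.
Proof.
case: m => [|m] /=.
  by under eq_bigr do rewrite expr0; rewrite sumr_const natr_card.
case: ifPn => [/dvdnP[k def_m] | ndvd].
  rewrite (bigD1 0) //= expr0n add0r.
  under eq_bigr => x x_neq0 do rewrite def_m mulnC exprM expf_card_pred // expr1n.
  by rewrite sumr_const -natr_card_pred -(cardC1 (0 : F)).
have [z z_prim] := has_prim_root_card_pred.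
have z_neq0 : z != 0.
  apply/eqP=> z0; have /eqP := prim_expr_order z_prim.
  by rewrite z0 expr0n gtn_eqF ?card_pred_gt0 // eq_sym oner_eq0.
have /eqP : \sum_x x ^+ m.+1 = \sum_x (z * x) ^+ m.+1 :> F.
  exact: (reindex_inj (mulfI z_neq0)).
under [in X in _ == X -> _]eq_bigr do rewrite exprMn.
rewrite -mulr_sumr eq_sym -subr_eq0 -[X in _ - X]mul1r -mulrBl mulf_eq0.
by rewrite subr_eq0 -(prim_order_dvd z_prim) (negbTE ndvd) => /eqP.
Qed.

(** Euler's criterion in counting form: a has one, two or no square roots
    according as a^n is 0, 1 or -1. *)
Lemma card_sqrt (a : F) : 2%:R != 0 :> F ->
  \sum_(y : F) (y ^+ 2 == a)%:R = 1 + a ^+ #|F|.-1./2.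
Proof.
move=> two_neq0; have := odd_card two_neq0; have := card_pred_gt0.
set n := _./2 => q_gt1 q_odd.
have def_q : #|F|.-1 = (2 * n)%N by rewrite /n; lia.
have n_gt0 : (0 < n)%N by lia.
have [-> | a_neq0] := eqVneq a 0.
  rewrite (bigD1 0) //= expr0n eqxx big1 ?expr0n ?gtn_eqF ?addr0 //= => y.
  by rewrite expf_eq0 /= => /negbTE->.
have sqr_exp y : y ^+ 2 = a -> a ^+ n = 1.
  move=> def_a; rewrite -def_a -exprM -def_q expf_card_pred //.
  by apply: contraNneq a_neq0 => y0; rewrite -def_a y0 expr0n.
have [/existsP[b /eqP def_a] | /existsPn no_root] :=
  boolP [exists b : F, b ^+ 2 == a].
  have b_neq0 : b != 0 by apply: contraNneq a_neq0 => b0; rewrite -def_a b0 expr0n.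
  have bN : - b != b.
    by rewrite eq_sym -addr_eq0 -mulr2n -mulr_natl mulf_neq0.
  rewrite (sqr_exp b def_a) (bigD1 b) //= (bigD1 (- b)) //= -def_a sqrrN eqxx.
  rewrite big1 ?addr0 // => y /andP[/negbTE y1 /negbTE y2].
  by rewrite eqf_sqr y1 y2.
(* Without a root, a^n = 1 is impossible: for a = z^k with z a generator, it
   would make k even, and then z^(k/2) would be a root. *)
rewrite big1 => [|y _]; last by rewrite (negbTE (no_root y)).
have [z z_prim] := has_prim_root_card_pred.
have [[k _] /= def_a] := prim_rootP z_prim (expf_card_pred a_neq0).
have : (a ^+ n) ^+ 2 == 1 by rewrite -exprM mulnC -def_q expf_card_pred.
rewrite sqrf_eq1 => /orP[|/eqP->]; last by rewrite subrr.
rewrite def_a -exprM -(prim_order_dvd z_prim) def_q dvdn_pmul2r //.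
move=> /dvdnP[j def_k]; have := no_root (z ^+ j).
by rewrite -exprM -def_k def_a eqxx.
Qed.

End FiniteField.

(** * Counting points of a hyperelliptic curve *)

Section HyperellipticPoints.
Variables (F : finFieldType) (g : nat).

Lemma homogenizeZ (f : {poly F}) (l X Z : F) :
  homogenize g f (l * X) (l * Z) = (l ^+ g.+1) ^+ 2 * homogenize g f X Z.
Proof.
rewrite /homogenize mulr_sumr; apply: eq_bigr => i _.
have -> : (l ^+ g.+1) ^+ 2 = l ^+ i * l ^+ (2 * g + 2 - i).
  by rewrite -exprM -exprD; congr (_ ^+ _); have := ltn_ord i; lia.
by rewrite !exprMn (mulrCA f`_i) mulrACA.
Qed.

Lemma homogenize00 (f : {poly F}) : homogenize g f 0 0 = 0.
Proof.
apply: big1 => i _; rewrite -mulrA -exprD expr0n gtn_eqF ?mulr0 //.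
by have := ltn_ord i; lia.
Qed.

Variable C : hyperelliptic_curve F g.

Lemma mem_weighted_orbit (X Y Z X' Y' Z' : F) :
  reflect (exists2 l, l != 0 & (X', Y', Z') = (l * X, l ^+ g.+1 * Y, l * Z))
          ((X', Y', Z') \in weighted_orbit g (X, Y, Z)).
Proof.
apply: (iffP imsetP) => [[l l_neq0 ->] | [l l_neq0 ->]]; exists l => //.
  by rewrite inE in l_neq0.
by rewrite inE.
Qed.

Lemma weighted_orbit_refl (P : F * F * F) : P \in weighted_orbit g P.
Proof.
case: P => [[X Y] Z]; apply/mem_weighted_orbit.
by exists 1; rewrite ?oner_eq0 // expr1n !mul1r.
Qed.

Lemma weighted_orbit_sub (P Q : F * F * F) :
  Q \in weighted_orbit g P -> weighted_orbit g Q \subset weighted_orbit g P.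
Proof.
case: P Q => [[X Y] Z] [[X' Y'] Z'] /mem_weighted_orbit[l l_neq0 [-> -> ->]].
apply/subsetP=> -[[X2 Y2] Z2] /mem_weighted_orbit[m m_neq0 [-> -> ->]].
apply/mem_weighted_orbit; exists (m * l); first by rewrite mulf_neq0.
by rewrite exprMn !mulrA.
Qed.

Lemma weighted_orbit_sym (P Q : F * F * F) :
  Q \in weighted_orbit g P -> P \in weighted_orbit g Q.
Proof.
case: P Q => [[X Y] Z] [[X' Y'] Z'] /mem_weighted_orbit[l l_neq0 [-> -> ->]].
apply/mem_weighted_orbit; exists l^-1; first by rewrite invr_eq0.
by rewrite exprVn !mulKf ?expf_neq0.
Qed.

(** Orbits of a group action that meet are equal; this makes the fibres of the
    orbit map the orbits themselves. *)
Lemma weighted_orbit_eq (P Q : F * F * F) :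
  (weighted_orbit g Q == weighted_orbit g P) = (Q \in weighted_orbit g P).
Proof.
apply/eqP/idP=> [<- | PQ]; first exact: weighted_orbit_refl.
by apply/eqP; rewrite eqEsubset !weighted_orbit_sub // weighted_orbit_sym.
Qed.

Lemma weighted_orbit_solutions P :
  P \in weighted_solutions C -> weighted_orbit g P \subset weighted_solutions C.
Proof.
case: P => [[X Y] Z]; rewrite inE => /andP[XZ_neq0 /eqP eqC].
apply/subsetP=> -[[X' Y'] Z'] /mem_weighted_orbit[l l_neq0 [-> -> ->]].
rewrite inE homogenizeZ exprMn eqC eqxx andbT.
apply: contraNneq XZ_neq0 => -[/eqP + /eqP].
by rewrite !mulf_eq0 (negbTE l_neq0) => /eqP-> /eqP->.
Qed.

(** The action is free: X and Z have weight 1 and do not both vanish, so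
    (l X, l Z) determines l. *)
Lemma card_weighted_orbit P :
  P \in weighted_solutions C -> #|weighted_orbit g P| = #|F|.-1.
Proof.
case: P => [[X Y] Z]; rewrite inE => /andP[XZ_neq0 _].
rewrite card_imset ?card_nonzero // => l m [/eqP eqX _ /eqP eqZ].
apply/eqP; apply: contraR XZ_neq0 => neq_lm; move: eqX eqZ.
rewrite -subr_eq0 -mulrBl mulf_eq0 subr_eq0 (negbTE neq_lm) => /eqP->.
by rewrite -subr_eq0 -mulrBl mulf_eq0 subr_eq0 (negbTE neq_lm) => /eqP->.
Qed.

Lemma card_weighted_solutions :
  #|weighted_solutions C| = (#|rational_points C| * #|F|.-1)%N.
Proof.
rewrite -sum1_card (partition_big_imset (weighted_orbit g)) /=.
rewrite -sum_nat_const; apply: eq_bigr => _ /imsetP[P solP ->].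
rewrite -(card_weighted_orbit solP) -sum1_card; apply: eq_bigl => Q.
rewrite weighted_orbit_eq; apply: andb_idl.
exact/subsetP/weighted_orbit_solutions.
Qed.

(** The sum over Y is innermost so that [card_sqrt] can evaluate it. *)
Lemma natr_card_weighted_solutions :
  #|weighted_solutions C|%:R =
    \sum_(X : F) \sum_(Z : F) \sum_(Y : F)
      ((X, Z) != (0, 0))%:R
      * (Y ^+ 2 == homogenize g (hyperelliptic_poly C) X Z)%:R :> F.
Proof.
under eq_bigr do rewrite exchange_big.
rewrite pair_bigA pair_bigA -sum1_card natr_sum big_mkcond /=.
apply: eq_bigr => -[[X Y] Z] _; rewrite inE /=.
by rewrite -natrM mulnb; case: ifP.
Qed.

(** The trace of Frobenius modulo the characteristic, as a sum over the whole
    plane.  Over F the orbit size q - 1 is -1, so the number of solutions is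
    the opposite of the number of points; the 1 is the contribution of
    the excluded pair (0, 0), where H vanishes. *)
Lemma hyperelliptic_trace :
  1 - #|rational_points C|%:R =
    \sum_(X : F) \sum_(Z : F)
      homogenize g (hyperelliptic_poly C) X Z ^+ #|F|.-1./2 :> F.
Proof.
have /andP[two_neq0 _] := hyperelliptic_polyP C.
have n_gt0 : (0 < #|F|.-1./2)%N.
  by have := odd_card two_neq0; have := card_pred_gt0 F; lia.
have -> : - #|rational_points C|%:R = #|weighted_solutions C|%:R :> F.
  by rewrite card_weighted_solutions natrM natr_card_pred mulrN1.
rewrite natr_card_weighted_solutions.
set H := homogenize _ _; set n := _./2.
(* The correction term is a product of two delta functions because such a
   product sums separately over X and Z. *)
have termE X Z : \sum_Y ((X, Z) != (0, 0))%:R * (Y ^+ 2 == H X Z)%:R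
    = 1 + H X Z ^+ n - ((Z == 0)%:R * (X == 0)%:R) :> F.
  rewrite -mulr_sumr card_sqrt // xpair_eqE.
  have [-> | _] := eqVneq X 0; have [-> | _] := eqVneq Z 0;
    rewrite /= ?mul1r ?mul0r ?mulr0 ?subr0 //.
  by rewrite /H homogenize00 expr0n gtn_eqF // addr0 subrr.
under eq_bigr do under eq_bigr do rewrite termE.
have sum_delta : \sum_(x : F) (x == 0)%:R = 1 :> F.
  by rewrite (bigD1 0) //= eqxx big1 ?addr0 // => x /negbTE->.
under eq_bigr do rewrite sumrB big_split /= -mulr_suml sum_delta mul1r.
rewrite sumrB big_split /= sum_delta !sumr_const natr_card mul0rn add0r.
by rewrite addrC subrK.
Qed.

End HyperellipticPoints.

(** * The curve y^2 = x^8 + c *)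

Lemma homogenize_X8_addC (F : fieldType) (c X Z : F) :
  homogenize 3 ('X^8 + c%:P) X Z = X ^+ 8 + c * Z ^+ 8.
Proof.
rewrite /homogenize !big_ord_recl big_ord0 !coefD !coefXn !coefC /=.
by rewrite !(add0r, addr0, mul0r, mul1r, mulr1) addrC.
Qed.

(** The i-th binomial term is C(n, i) c^i times the power sums of exponents
    8 (n - i) and 8 i.  Both are nonzero exactly when 0 < i < n and n | 4 i, and
    then their product is (-1)^2 = 1. *)
Lemma sum_X8_addC_exp (F : finFieldType) (c : F) (n : nat) :
    #|F|.-1 = (2 * n)%N ->
  \sum_(X : F) \sum_(Z : F) (X ^+ 8 + c * Z ^+ 8) ^+ n
    = \sum_(0 <= i < n | (0 < i)%N && (n %| 4 * i)%N) 'C(n, i)%:R * c ^+ i.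
Proof.
move=> def_q.
under eq_bigr => X _ do under eq_bigr => Z _ do rewrite exprDn.
under eq_bigr do rewrite exchange_big /=.
rewrite exchange_big /=.
transitivity (\sum_(i < n.+1) 'C(n, i)%:R * c ^+ i
   * ((\sum_(X : F) X ^+ (8 * (n - i))) * (\sum_(Z : F) Z ^+ (8 * i)))).
  apply: eq_bigr => i _; rewrite big_distrlr mulr_sumr.
  apply: eq_bigr => X _; rewrite mulr_sumr; apply: eq_bigr => Z _ /=.
  rewrite [(c * _) ^+ i]exprMn -!exprM -mulr_natl.
  by rewrite [X ^+ _ * (_ * _)]mulrCA mulrA.
rewrite big_ord_recr /= subnn muln0 power_sum /= mul0r mulr0 addr0.
rewrite big_mkord [RHS]big_mkcond; apply: eq_bigr => i _.
rewrite !power_sum def_q !muln_gt0 subn_gt0 ltn_ord /=.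
have dvd8 m : (2 * n %| 8 * m)%N = (n %| 4 * m)%N.
  by rewrite -[8%N]/(2 * 4)%N -mulnA dvdn_pmul2l.
have dvd_sub : (n %| 4 * (n - i))%N = (n %| 4 * i)%N.
  have le_4i : (4 * i <= 4 * n)%N by have := ltn_ord i; lia.
  by rewrite mulnBr; apply: (dvdn_subr le_4i); apply: dvdn_mull.
rewrite !dvd8 dvd_sub andbC.
case: (n %| _)%N => /=; last by rewrite mul0r mulr0.
by case: ifP => _; rewrite ?mulr0 // mulN1r opprK mulr1.
Qed.

Theorem mainTheorem2 (c : rat) (c_neq0 : c != 0) (p : nat) (p_pr : prime p)
    (p_gt3 : (3 < p)%N) (vpc : padic_valuation p c = 0) :
  let n := ((p - 1) %/ 2)%N in
  let cbar : 'F_p := ratr c in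
  (frobenius_trace (C1_good_reduction c_neq0 p_pr p_gt3 vpc))%:~R =
    (if (p %% 8 == 1)%N then
       'C(n, n %/ 2)%:R * cbar ^+ (n %/ 2)
       + 'C(n, n %/ 4)%:R * cbar ^+ (n %/ 4)
       + 'C(n, n %/ 4)%:R * cbar ^+ (3 * n %/ 4)
     else if (p %% 8 == 5)%N then
       'C(n, n %/ 2)%:R * cbar ^+ (n %/ 2)
     else 0) :> 'F_p.
Proof.
move=> n cbar.
have p_odd : odd p by case: (even_prime p_pr) p_gt3 => [->|].
have q_pred : #|'F_p|.-1 = (2 * n)%N by rewrite card_Fp // /n; lia.
have -> : (frobenius_trace (C1_good_reduction c_neq0 p_pr p_gt3 vpc))%:~R
    = \sum_(X : 'F_p) \sum_(Z : 'F_p) (X ^+ 8 + cbar * Z ^+ 8) ^+ n.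
  rewrite /frobenius_trace !(rmorphB, rmorphD) /= -!pmulrn.
  rewrite pchar_Fp_0 // add0r hyperelliptic_trace /=.
  apply: eq_bigr => X _; apply: eq_bigr => Z _.
  rewrite reduce_X8_addC homogenize_X8_addC q_pred.
  by congr (_ ^+ _); lia.
rewrite sum_X8_addC_exp //.
(* It remains to list the indices that occur. *)
have sumE s : uniq s ->
    (forall i, (i \in s) = [&& (0 < i)%N, (n %| 4 * i)%N & (i < n)%N]) ->
  \sum_(0 <= i < n | (0 < i)%N && (n %| 4 * i)%N) 'C(n, i)%:R * cbar ^+ i
    = \sum_(i <- s) 'C(n, i)%:R * cbar ^+ i.
  move=> s_uniq mem_s; rewrite -big_filter; apply: perm_big.
  apply: uniq_perm => // [|i]; first by rewrite filter_uniq ?iota_uniq.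
  by rewrite mem_filter mem_index_iota mem_s -andbA.
(* The quotient 4 i / n lies strictly between 0 and 4. *)
have dvd4 i : (0 < i)%N -> (i < n)%N -> (n %| 4 * i)%N =
    [|| 4 * i == n, 4 * i == 2 * n | 4 * i == 3 * n]%N.
  move=> i_gt0 lt_in; apply/idP/idP => [/dvdnP[k def_k] | ].
    have : (0 < k < 4)%N by nia.
    by case: k def_k => [|[|[|[|k]]]] // -> _; lia.
  by case/or3P=> /eqP->; rewrite ?dvdn_mull.
have def_p : (p = 2 * n + 1)%N by rewrite /n; lia.
case: ifP => [p1 | p_n1]; last case: ifP => [p5 | p_n5].
- have [m def_n] : exists m, n = (4 * m)%N by exists (p %/ 8)%N; lia.
  have [-> -> ->] : [/\ n %/ 4 = m, n %/ 2 = 2 * m & 3 * n %/ 4 = 3 * m]%N.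
    by split; lia.
  rewrite (sumE [:: 2 * m; m; 3 * m]%N).
  (* The statement pairs C(n, n/4) with c^(3n/4): use the symmetry of
     binomial coefficients. *)
  + rewrite !big_cons big_nil addr0 addrA -[in 'C(n, 3 * m)]bin_sub; last lia.
    by have -> : (n - 3 * m = m)%N by lia.
  + by rewrite /= !inE; lia.
  + move=> i; rewrite !inE; apply/idP/idP => [|/and3P[i_gt0 + lt_in]].
      by move=> i_s; apply/and3P; split; first lia; last lia; rewrite dvd4; lia.
    by rewrite dvd4 //; lia.
- rewrite (sumE [:: n %/ 2]%N) ?big_seq1 // => i; rewrite inE.
  apply/eqP/idP => [->|/and3P[i_gt0 + lt_in]]; last by rewrite dvd4 //; lia.
  by apply/and3P; split; first lia; last lia; rewrite dvd4; lia.
rewrite (sumE [::]) ?big_nil // => i; apply/esym/negP => /and3P[i_gt0 + lt_in].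
by rewrite dvd4 //; lia.
Qed.
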